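(* Let $A\in\mathbb{C}^{m\times n}$ have rank $a$, let $B\in\mathbb{C}^{k\times l}$ have rank $b$, and let $C\in\mathbb{C}^{m\times l}$ be such that the matrix equation $AXB=C$ has a solution $X\in\mathbb{C}^{n\times k}$. Let $Q\in\mathbb{C}^{m\times m}$, $P\in\mathbb{C}^{n\times n}$, $R\in\mathbb{C}^{k\times k}$, $S\in\mathbb{C}^{l\times l}$ be regular matrices such that $QAP=E_a$ and $RBS=E_b$. Then the general solution of $AXB=C$ is $$X=P\left[\begin{array}{c|c} G_{ab} & F\\ \hline H & L\end{array}\right]R,$$ where $G_{ab}\in\mathbb{C}^{a\times b}$ is the submatrix of $QCS$ formed by its first $a$ rows and first $b$ columns, and the entries of $F\in\mathbb{C}^{a\times(k-b)}$, $H\in\mathbb{C}^{(n-a)\times b}$ and $L\in\mathbb{C}^{(n-a)\times(k-b)}$ are $nk-ab$ free parameters; that is, the set of all solutions $X\in\mathbb{C}^{n\times k}$ of $AXB=C$ equals the set of all matrices of this form with $F,H,L$ arbitrary.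
   Context: A regular matrix is an invertible square matrix. $E_a=\left[\begin{array}{c|c} I_a & 0\\ \hline 0&0\end{array}\right]\in\mathbb{C}^{m\times n}$ and $E_b=\left[\begin{array}{c|c} I_b & 0\\ \hline 0&0\end{array}\right]\in\mathbb{C}^{k\times l}$. Blocks may be empty. *)

(* Defs.v *)
From mathcomp Require Import all_boot all_algebra.
From mathcomp Require Import reals.
From mathcomp.real_closed Require Import complex.

Set Implicit Arguments.
Unset Strict Implicit.
Unset Printing Implicit Defensive.

Import GRing.Theory.

Section Rank.
Variables (F : fieldType) (m n r : nat) (A : 'M[F]_(m, n)).

Lemma rank_eq_leq_row : \rank A = r -> r <= m.
Proof. by move=> <-; exact: rank_leq_row. Qed.

Lemma rank_eq_leq_col : \rank A = r -> r <= n.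
Proof. by move=> <-; exact: rank_leq_col. Qed.

End Rank.

Section Blocks.
Variable T : Type.

Definition leading_submx (a b m l : nat) (leam : a <= m) (lebl : b <= l)
    (M : 'M[T]_(m, l)) : 'M[T]_(a, b) :=
  mxsub (widen_ord leam) (widen_ord lebl) M.

(* The cast only identifies the dimensions a + (n - a) and b + (k - b) of the
   block matrix with n and k. *)
Definition bordered_mx (a b n k : nat) (lean : a <= n) (lebk : b <= k)
    (G : 'M[T]_(a, b)) (F : 'M[T]_(a, k - b))
    (H : 'M[T]_(n - a, b)) (L : 'M[T]_(n - a, k - b)) : 'M[T]_(n, k) :=
  castmx (subnKC lean, subnKC lebk) (block_mx G F H L).

End Blocks.

(* Main.v *)
Require Import Defs.
From mathcomp Require Import all_boot all_algebra.
From mathcomp Require Import reals.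
From mathcomp.real_closed Require Import complex.

(** The change of variable [Y = P^-1 X R^-1] turns [A X B = C] into
    [E_a Y E_b = D] with [D = Q C S], because [Q], [P], [R] and [S] are regular
    ([mulmx_equiv_eq]).  Multiplication by [E_a] and [E_b] keeps the leading
    [a x b] block of [Y] and replaces everything else by zero, so [E_a Y E_b]
    and the leading block of [Y] determine each other ([pid_mx_sandwich_eq]).
    Solvability means that [D] itself has the form [E_a Y0 E_b]; hence [Y] is a
    solution exactly when its leading block agrees with that of [D], which
    leaves the three other blocks free ([leading_submx_eqP]).  Together with the
    fixed [a x b] block they fill an [n x k] matrix, hence the number of
    parameters. *)

Set Implicit Arguments.
Unset Strict Implicit.
Unset Printing Implicit Defensive.

Import GRing.Theory.
Local Open Scope ring_scope.

(** The two dimension identifications agree on indices: the inclusions of [a]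
    into [n] and into [a + (n - a)] have the same underlying numbers. *)
Lemma leading_submx_cast (T : Type) (a b n k : nat) (lean : (a <= n)%N)
    (lebk : (b <= k)%N) (M : 'M[T]_(a + (n - a), b + (k - b))) :
  leading_submx lean lebk (castmx (subnKC lean, subnKC lebk) M) = ulsubmx M.
Proof.
apply/matrixP=> i j; rewrite !mxE castmxE.
by congr (M _ _); apply: val_inj.
Qed.

Lemma leading_submx_eqP (T : Type) (a b n k : nat) (lean : (a <= n)%N)
    (lebk : (b <= k)%N) (G : 'M[T]_(a, b)) (Y : 'M[T]_(n, k)) :
  leading_submx lean lebk Y = G <->
  exists (F : 'M[T]_(a, k - b)) (H : 'M[T]_(n - a, b))
         (L : 'M[T]_(n - a, k - b)), Y = bordered_mx lean lebk G F H L.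
Proof.
split=> [<- | [F [H [L ->]]]]; last first.
  by rewrite /bordered_mx leading_submx_cast block_mxKul.
set eqs := (subnKC lean, subnKC lebk).
pose M := castmx (esym eqs.1, esym eqs.2) Y.
have defY : Y = castmx eqs M by rewrite castmxKV.
exists (ursubmx M), (dlsubmx M), (drsubmx M).
by rewrite {2}defY leading_submx_cast /bordered_mx submxK.
Qed.

(** The rectangular partial identities are the inclusion and projection of
    coordinates, so compressing by them selects the leading block. *)
Lemma leading_submxE (K : pzSemiRingType) (a b n k : nat) (lean : (a <= n)%N)
    (lebk : (b <= k)%N) (Y : 'M[K]_(n, k)) :
  leading_submx lean lebk Y =
    (pid_mx a : 'M_(a, n)) *m Y *m (pid_mx b : 'M_(k, b)).
Proof.
apply/matrixP=> i j; rewrite !mxE (bigD1 (widen_ord lebk j)) //=.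
rewrite [X in _ + X]big1 ?addr0 => [|j' /negbTE nej']; last first.
  by rewrite [pid_mx b _ _]mxE (nej' : (j' == j :> nat) = false) mulr0.
rewrite [pid_mx b _ _]mxE /= eqxx ltn_ord mulr1.
rewrite !mxE (bigD1 (widen_ord lean i)) //=.
rewrite [X in _ + X]big1 ?addr0 => [|i' /negbTE nei']; last first.
  by rewrite mxE eq_sym (nei' : (i' == i :> nat) = false) mul0r.
by rewrite mxE /= eqxx ltn_ord mul1r.
Qed.

(** Each [E_r] factors through [r]-dimensional space.  Thus [E_a Y E_b] is the
    leading block of [Y] padded with zeros, and conversely the leading block of
    [E_a Y E_b] is that of [Y]. *)
Lemma pid_mx_sandwich_eq (K : pzSemiRingType) (m n k l a b : nat)
    (leam : (a <= m)%N) (lean : (a <= n)%N)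
    (lebk : (b <= k)%N) (lebl : (b <= l)%N)
    (Y Y0 : 'M[K]_(n, k)) :
  (pid_mx a : 'M_(m, n)) *m Y *m (pid_mx b : 'M_(k, l)) =
  (pid_mx a : 'M_(m, n)) *m Y0 *m (pid_mx b : 'M_(k, l)) <->
  leading_submx lean lebk Y =
  leading_submx leam lebl
    ((pid_mx a : 'M_(m, n)) *m Y0 *m (pid_mx b : 'M_(k, l))).
Proof.
have lead_sandwich Z : leading_submx leam lebl
    ((pid_mx a : 'M_(m, n)) *m Z *m (pid_mx b : 'M_(k, l))) =
    leading_submx lean lebk Z.
  rewrite !leading_submxE !mulmxA pid_mx_id // -!mulmxA.
  by rewrite pid_mx_id.
have pad_lead Z : (pid_mx a : 'M_(m, n)) *m Z *m (pid_mx b : 'M_(k, l)) =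
    (pid_mx a : 'M_(m, a)) *m leading_submx lean lebk Z
      *m (pid_mx b : 'M_(b, l)).
  rewrite leading_submxE !mulmxA pid_mx_id // -!mulmxA.
  by rewrite pid_mx_id.
rewrite lead_sandwich; split=> [eqYY0 | eq_lead].
  by rewrite -!lead_sandwich eqYY0.
by rewrite !pad_lead eq_lead.
Qed.

Lemma mulmx_equiv_eq (K : comUnitRingType) (m n k l : nat)
    (A : 'M[K]_(m, n)) (B : 'M[K]_(k, l)) (C : 'M[K]_(m, l))
    (Q : 'M[K]_m) (P : 'M[K]_n) (R : 'M[K]_k) (S : 'M[K]_l)
    (X : 'M[K]_(n, k)) :
  Q \in unitmx -> P \in unitmx -> R \in unitmx -> S \in unitmx ->
  A *m X *m B = C <->
  (Q *m A *m P) *m (invmx P *m X *m invmx R) *m (R *m B *m S) = Q *m C *m S.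
Proof.
move=> Qreg Preg Rreg Sreg.
have -> : (Q *m A *m P) *m (invmx P *m X *m invmx R) *m (R *m B *m S) =
    Q *m (A *m X *m B) *m S.
  by rewrite !mulmxA mulmxK // mulmxKV.
split=> [-> // | eqQS].
by apply: (can_inj (mulKmx Qreg)); apply: (can_inj (mulmxK Sreg)).
Qed.

Lemma bordering_sizeE (a b n k : nat) : (a <= n)%N -> (b <= k)%N ->
  (a * (k - b) + (n - a) * b + (n - a) * (k - b) = n * k - a * b)%N.
Proof.
move=> lean lebk; rewrite -addnA -mulnDr (subnKC lebk) mulnBr mulnBl.
by rewrite addnC addnBA ?leq_mul2l ?lebk ?orbT // subnK // leq_mul2r lean orbT.
Qed.

Theorem mainTheorem9 (T : realType) (m n k l a b : nat)
  (A : 'M[T[i]]_(m, n)) (B : 'M[T[i]]_(k, l)) (C : 'M[T[i]]_(m, l))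
  (rankA : \rank A = a) (rankB : \rank B = b)
  (solvable : exists X0 : 'M[T[i]]_(n, k), A *m X0 *m B = C)
  (Q : 'M[T[i]]_m) (P : 'M[T[i]]_n) (R : 'M[T[i]]_k) (S : 'M[T[i]]_l)
  (Qreg : Q \in unitmx) (Preg : P \in unitmx)
  (Rreg : R \in unitmx) (Sreg : S \in unitmx)
  (QAP : Q *m A *m P = pid_mx a) (RBS : R *m B *m S = pid_mx b) :
  (forall X : 'M[T[i]]_(n, k),
     A *m X *m B = C <->
     exists (F : 'M[T[i]]_(a, k - b)) (H : 'M[T[i]]_(n - a, b))
            (L : 'M[T[i]]_(n - a, k - b)),
       X = P *m bordered_mx (rank_eq_leq_col rankA) (rank_eq_leq_row rankB)
                  (leading_submx (rank_eq_leq_row rankA)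
                     (rank_eq_leq_col rankB) (Q *m C *m S))
                  F H L *m R)
  /\ (a * (k - b) + (n - a) * b + (n - a) * (k - b) = n * k - a * b)%N.
Proof.
split; last exact: bordering_sizeE (rank_eq_leq_col rankA) (rank_eq_leq_row rankB).
case: solvable => X0 /(mulmx_equiv_eq _ _ _ _ Qreg Preg Rreg Sreg) defD X.
rewrite (mulmx_equiv_eq _ _ _ X Qreg Preg Rreg Sreg) -defD QAP RBS.
set Y := invmx P *m X *m invmx R.
rewrite (pid_mx_sandwich_eq (rank_eq_leq_row rankA) (rank_eq_leq_col rankA)
           (rank_eq_leq_row rankB) (rank_eq_leq_col rankB)) leading_submx_eqP.
have defX Z : Y = Z <-> X = P *m Z *m R.
  split=> [<- | defX]; first by rewrite /Y !mulmxA mulmxV // mul1mx mulmxKV.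
  by rewrite /Y defX -mulmxA mulmxK // mulKmx.
by split=> -[F [H [L /defX eqFHL]]]; exists F, H, L.
Qed.
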